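(* Let $F: C_b(\mathbb{R},\mathbb{R}^m)\to C_b(\mathbb{R},\mathbb{R}^m)$ be $p$-continuous and suppose that the associated map $\tilde F$ has exactly two zeros, $0$ and $u_2$, in the rectangle $[0,u_2]\subset \mathbb{R}^m_+$. Suppose that there exists a linear $p$-continuous operator $L: C_b(\mathbb{R},\mathbb{R}^m)\to C_b(\mathbb{R},\mathbb{R}^m)$ such that the differential operator $\mathcal{D}: C^2_b(\mathbb{R},\mathbb{R}^m)\to C_b(\mathbb{R},\mathbb{R}^m)$ defined by $$\mathcal{D}\phi(t) = D\phi''(t)-c\phi'(t)-(L\phi)(t),\quad t\in\mathbb{R},$$ has the inverse integral operator $$\mathcal{I}f(t)=\mathcal{D}^{-1}f(t)=\int_{\mathbb{R}}N(t-s)f(s)\,ds,$$ with non-positive continuous matrix-valued kernel $N:\mathbb{R}\to M_m(\mathbb{R}_-)$ (all entries of $N(s)$ are $\le 0$). If, in addition, (a) the operator $F+L$ preserves the natural componentwise order of $C_b(\mathbb{R},\mathbb{R}^m)$: $F(\psi)-F(\phi)+L(\psi-\phi)\ge 0$ for all $\psi\ge\phi$, $\psi,\phi\in C_b(\mathbb{R},\mathbb{R}^m)$; (b) there is a pair of sub- and super-solutions $\phi_-(t)\le\phi_+(t)$, $t \in \mathbb{R}$, of the boundary value problem $$D\phi''(t)-c\phi'(t)+F(\phi)(t)=0,\quad \phi(-\infty)=0,\quad \phi(+\infty)=u_2; \qquad (\ast)$$ (c) $L$ and $F$ commute with the translation operator $(T_s\phi)(t):=\phi(t+s)$ for all $s\in\mathbb{R}$,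 then $(\ast)$ has a monotone solution $\phi_*(t)$ coinciding with the pointwise limit of the decreasing sequence of non-decreasing functions $\phi_{n+1}=-\mathcal{I}[F(\phi_n)+L\phi_n]$, $n=0,1,\dots$, $\phi_0:=\phi_+$.
   Context: $D=\mathrm{diag}\{d_1,\dots,d_m\}$ is a diagonal matrix with $d_j>0$, $c\in\mathbb{R}$ is a parameter, and $u_2=(\kappa_1,\dots,\kappa_m)$ with all $\kappa_j>0$. $C_b(\mathbb{R},\mathbb{R}^m)$ is the space of continuous bounded functions with the sup-norm, and $C_b^2(\mathbb{R},\mathbb{R}^m)$ is the space of twice continuously differentiable functions that are bounded together with their first and second derivatives. Inequalities between vectors and between vector functions are componentwise; ''decreasing'' for the sequence means with respect to $n$, pointwise. Solutions take values in $\mathbb{R}^m_+$. A map $G: C_b(\mathbb{R},\mathbb{R}^m)\to C_b(\mathbb{R},\mathbb{R}^m)$ is $p$-continuous if for every bounded sequence $\{\zeta_n\}$ in $C_b(\mathbb{R},\mathbb{R}^m)$ converging pointwise to some $\zeta_*\in C_b(\mathbb{R},\mathbb{R}^m)$, the sequence $G(\zeta_n)(t)$ converges to $G(\zeta_* )(t)$ at each $t\in\mathbb{R}$. When $F$ commutes with translations, it maps constant functions to constant functions, and $\tilde F:\mathbb{R}^m\to\mathbb{R}^m$ denotes the restriction of $F$ to constant functions: $\tilde F(x)=F(\phi)(t)$ where $\phi(t)\equiv x$. A super-solution of $(\ast)$ is a continuous, componentwise positive, nondecreasing function $\phi_+:\mathbb{R}\to\mathbb{R}^m_+$ that is $C_b^2$-smooth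 on $\mathbb{R}\setminus\{t_1\}$ for some $t_1 \in \mathbb{R}$, with $\phi_+(+\infty)=u_2$, $\phi_+(-\infty)=0$, satisfying $$D\phi_+''(t)-c\phi_+'(t)+F(\phi_+)(t)\le 0,\ t\ne t_1,\qquad \phi_+'(t_1-)\ge\phi_+'(t_1+).$$ A sub-solution of $(\ast)$ is a continuous non-negative function $\phi_-:\mathbb{R}\to\mathbb{R}^m_+$ with every component non-constant, $C_b^2$-smooth on $\mathbb{R}\setminus\{t_2\}$ for some $t_2\in\mathbb{R}$, with $\phi_-(-\infty)=0$, satisfying $$D\phi_-''(t)-c\phi_-'(t)+F(\phi_-)(t)\ge 0,\ t\ne t_2,\qquad \phi_-'(t_2-)\le\phi_-'(t_2+).$$ *)

(* Defs.v *)
From HB Require Import structures.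
From mathcomp Require Import all_boot all_order all_algebra.
From mathcomp Require Import all_classical all_reals all_analysis.

Set Implicit Arguments.
Unset Strict Implicit.
Unset Printing Implicit Defensive.

Import Order.TTheory GRing.Theory Num.Theory.
Import numFieldNormedType.Exports.

Local Open Scope ring_scope.
Local Open Scope classical_set_scope. (* opened last: ^`() is derive1 *)

Section Defs.
Context {R : realType} {m : nat}.

Definition mxle p q (A B : 'M[R]_(p, q)) : Prop := forall i j, A i j <= B i j.

Implicit Types (f phi psi : R -> 'cV[R]_m) (F G L : (R -> 'cV[R]_m) -> R -> 'cV[R]_m).

Definition bounded_on (A : set R) f : Prop :=
  exists M : R, forall t, A t -> `|f t| <= M.

(* C_b(R, R^m), as a subset of all functions. Operators on C_b are maps on all
   functions that send this set into itself; their values outside it are never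
   used. *)
Definition Cb : set (R -> 'cV[R]_m) :=
  [set f | continuous f /\ bounded_on setT f].

(* C_b^2-smoothness on an open set A; the values of [f^`()] outside A play no
   role since A is open. *)
Definition Cb2_on (A : set R) : set (R -> 'cV[R]_m) :=
  [set f | [/\ forall t, A t -> derivable f t 1,
               forall t, A t -> derivable f^`() t 1,
               forall t, A t -> {for t, continuous f^`(2)} &
               [/\ bounded_on A f, bounded_on A f^`() & bounded_on A f^`(2)]]].

Definition Cb2 : set (R -> 'cV[R]_m) := Cb2_on setT.

Definition p_continuous G : Prop :=
  forall (zeta : nat -> R -> 'cV[R]_m) (zetas : R -> 'cV[R]_m),
    (forall n, Cb (zeta n)) ->
    (exists M : R, forall n t, `|zeta n t| <= M) ->
    Cb zetas ->
    (forall t, zeta n t @[n --> \oo] --> zetas t) ->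
    forall t, G (zeta n) t @[n --> \oo] --> G zetas t.

Definition linear_on_Cb L : Prop :=
  forall (a : R) phi psi, Cb phi -> Cb psi ->
    L (fun t => a *: phi t + psi t) = (fun t => a *: L phi t + L psi t).

Definition commutes_with_translations G : Prop :=
  forall (s : R) phi, Cb phi -> G (phi \o shift s) = G phi \o shift s.

(* Restriction to constant functions; when F commutes with translations,
   F (cst x) is constant and the evaluation point 0 is irrelevant. *)
Definition on_constants F (x : 'cV[R]_m) : 'cV[R]_m := F (cst x) 0.

Definition wave_op (d : 'rV[R]_m) (c : R) F phi (t : R) : 'cV[R]_m :=
  diag_mx d *m phi^`(2)%classic t - c *: phi^`()%classic t + F phi t.

Definition lin_op (d : 'rV[R]_m) (c : R) L phi (t : R) : 'cV[R]_m :=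
  diag_mx d *m phi^`(2)%classic t - c *: phi^`()%classic t - L phi t.

Definition conv_op (N : R -> 'M[R]_m) f (t : R) : 'cV[R]_m :=
  \col_i Rintegral (@lebesgue_measure R) setT (fun s => (N (t - s) *m f s) i 0).

(* The convolution with N is a well-defined operator from C_b to C_b^2 and is
   the two-sided inverse of [lin_op d c L] : C_b^2 -> C_b. Integrability is
   stated because [Rintegral] is a total function. *)
Definition inverse_integral_op (d : 'rV[R]_m) (c : R) L (N : R -> 'M[R]_m)
    : Prop :=
  [/\ forall f, Cb f -> forall t i,
        (@lebesgue_measure R).-integrable setT
          (fun s => ((N (t - s) *m f s) i 0)%:E),
      forall f, Cb f -> Cb2 (conv_op N f),
      forall f, Cb f -> lin_op d c L (conv_op N f) = f &
      forall phi, Cb2 phi -> conv_op N (lin_op d c L phi) = phi].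

Definition nondecreasing_vec phi : Prop :=
  forall s t : R, s <= t -> mxle (phi s) (phi t).

Definition super_solution (d : 'rV[R]_m) (c : R) (u2 : 'cV[R]_m) F phi
    : Prop :=
  [/\ continuous phi,
      forall t i, 0 < phi t i 0,
      nondecreasing_vec phi,
      (phi t @[t --> +oo%R] --> u2) /\ (phi t @[t --> -oo%R] --> (0 : 'cV[R]_m)) &
      exists t1 : R,
        [/\ Cb2_on (~` [set t1]) phi,
            forall t, t != t1 -> mxle (wave_op d c F phi t) 0 &
            exists l r : 'cV[R]_m,
              [/\ phi^`() t @[t --> t1^'-] --> l,
                  phi^`() t @[t --> t1^'+] --> r & mxle r l]]].

Definition sub_solution (d : 'rV[R]_m) (c : R) F phi : Prop :=
  [/\ continuous phi,
      forall t, mxle 0 (phi t),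
      forall i, ~ exists k : R, forall t, phi t i 0 = k,
      phi t @[t --> -oo%R] --> (0 : 'cV[R]_m) &
      exists t2 : R,
        [/\ Cb2_on (~` [set t2]) phi,
            forall t, t != t2 -> mxle 0 (wave_op d c F phi t) &
            exists l r : 'cV[R]_m,
              [/\ phi^`() t @[t --> t2^'-] --> l,
                  phi^`() t @[t --> t2^'+] --> r & mxle l r]]].

Definition bvp_solution (d : 'rV[R]_m) (c : R) (u2 : 'cV[R]_m) F phi : Prop :=
  [/\ Cb2 phi,
      forall t, mxle 0 (phi t),
      forall t, wave_op d c F phi t = 0,
      phi t @[t --> -oo%R] --> (0 : 'cV[R]_m) &
      phi t @[t --> +oo%R] --> u2].

Definition iterates (N : R -> 'M[R]_m) F L (phi0 : R -> 'cV[R]_m) (n : nat)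
    : R -> 'cV[R]_m :=
  iter n (fun phi t => - conv_op N (fun s => F phi s + L phi s) t) phi0.

End Defs.

(* Main.v *)
Require Import Defs.
From HB Require Import structures.
From mathcomp Require Import all_boot all_order all_algebra.
From mathcomp Require Import all_classical all_reals all_analysis.
From mathcomp Require Import ring lra.

Set Implicit Arguments.
Unset Strict Implicit.
Unset Printing Implicit Defensive.

Import Order.TTheory GRing.Theory Num.Theory.
Import numFieldNormedType.Exports.

Local Open Scope classical_set_scope.
Local Open Scope ring_scope.

(** Write [A phi = F phi + L phi] and [T phi = - conv_op N (A phi)]. A fixed point of
[T] in [Cb] is a solution of the wave equation, because [conv_op N] inverts [lin_op],
and [T] is monotone because [A] is and the kernel is non-positive. It also commutes
with translations, so it preserves monotone profiles. The theorem is thus the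
monotone iteration of [T] between a sub- and a super-solution, and four
points need an argument.

A super-solution satisfies [T phi <= phi] ([super_solution_picard_le]). It is not in
[Cb2], so [conv_op N] cannot be applied to [lin_op phi] directly; it is
regularised by taking second difference quotients of a second primitive. The
downward jump of the derivative keeps these bounded from above
([second_difference_le]), which is enough to pass to the limit in the convolution
([conv_op_limsup], [conv_op_le_kinked]). The sub-solution is treated by applying the
same comparison to its opposite.

The pointwise limit [phis] of the decreasing iterates is continuous: the equation
bounds the first derivatives of all iterates but the first at once ([derive1_bound],
[picard_equilipschitz]), where [L] maps bounded sets to bounded sets by p-continuity
and translation invariance ([p_continuous_bounded]).

The limit is a fixed point: [A] passes to the limit by p-continuity and the
convolution by dominated convergence ([picard_limit], [iterates_cvg_fixpoint]).

The boundary values are right: at minus infinity, [phis] is squeezed between [0] and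
the super-solution. At plus infinity, the monotone [phis] has a limit [x] between [0]
and [u2], and translating to the right shows that the constant [x] is a fixed point
as well, so [x] is a zero of [F] on constants ([fixpoint_limit_is_zero]). It is not
[0], because [phis] lies above the non-constant, non-negative sub-solution; hence it
is [u2]. *)

(** * Second differences of functions with a downward kink *)

Section RealCalculus.
Context {R : realType}.
Implicit Types (f g df : R -> R) (a b t K M e : R).

Lemma norm_le_between (x y z p q : R) :
  x <= y -> y <= z -> `|x| <= p -> `|z| <= q -> `|y| <= `|p| + `|q|.
Proof.
have := ler_norm p; have := ler_norm q.
have := normr_ge0 p; have := normr_ge0 q.
by rewrite !ler_norml => ? ? ? ? ? ? /andP[? ?] /andP[? ?]; apply/andP; split; lra.
Qed.

Lemma is_derive1_continuous f t (df : R) :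
  is_derive t 1 f df -> {for t, continuous f}.
Proof.
by move=> [fD _]; apply: differentiable_continuous; exact/derivable1_diffP.
Qed.

Lemma mean_value_le f df a b K : a <= b ->
  {within `[a, b], continuous f} ->
  (forall x : R, a < x < b -> is_derive x 1 f (df x)) ->
  (forall x : R, a < x < b -> df x <= K) ->
  f b - f a <= K * (b - a).
Proof.
rewrite le_eqVlt => /predU1P[->|ab] fc fD dfK; first by rewrite !subrr mulr0.
have [x xab ->] := MVT ab (fun x xab => fD x xab) fc.
by rewrite ler_wpM2r ?subr_ge0 ?(ltW ab)// dfK.
Qed.

Lemma mean_value_le_off f df t1 a b K : a <= b -> continuous f ->
  (forall x : R, a < x < b -> x != t1 -> is_derive x 1 f (df x)) ->
  (forall x : R, a < x < b -> x != t1 -> df x <= K) ->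
  f b - f a <= K * (b - a).
Proof.
move=> ab fc fD dfK.
have fw u v : {within `[u, v], continuous f} by exact: continuous_subspaceT.
have [/andP[at1 t1b]|t1out] := boolP (a < t1 < b); last first.
  have xt1 x : a < x < b -> x != t1.
    by move=> xab; apply: contraNneq t1out => <-.
  by apply: (mean_value_le (df := df) ab (fw _ _)) => x xab;
    [apply: fD|apply: dfK] => //; exact: xt1.
have le1 : f t1 - f a <= K * (t1 - a).
  apply: (mean_value_le (df := df) (ltW at1) (fw _ _)) => x /andP[ax xt1];
    [apply: fD|apply: dfK]; rewrite ?lt_eqF// ax/=; exact: lt_trans t1b.
have le2 : f b - f t1 <= K * (b - t1).
  apply: (mean_value_le (df := df) (ltW t1b) (fw _ _)) => x /andP[t1x xb];
    [apply: fD|apply: dfK]; rewrite ?gt_eqF// xb andbT; exact: lt_trans t1x.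
lra.
Qed.

(** Away from [t1] this is the mean value inequality; across [t1] it survives
because the jump [r - l] of the derivative can only decrease the increment.
The last two conclusions give the increments that start or end at [t1], with
the larger limit [l] as the value of the derivative there. *)
Lemma derive_increment_le g1 g2 t1 l r M a b :
  (forall x, x != t1 -> is_derive x 1 g1 (g2 x)) ->
  g1 x @[x --> t1^'-] --> l -> g1 x @[x --> t1^'+] --> r -> r <= l ->
  (forall x : R, a < x < b -> x != t1 -> g2 x <= M) ->
  (forall x y, a < x -> x < y -> y < b -> x != t1 -> y != t1 ->
     g1 y - g1 x <= M * (y - x)) /\
  (forall x, a < t1 -> t1 < x -> x < b -> g1 x - l <= M * (x - t1)) /\
  (forall x, a < x -> x < t1 -> t1 < b -> l - g1 x <= M * (t1 - x)).
Proof.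
move=> gD gl gr rl gM.
have side x y : a < x -> x < y -> y < b -> ~~ (x <= t1 <= y) ->
    g1 y - g1 x <= M * (y - x).
  move=> ax xy yb t1out.
  have ne z : x <= z <= y -> z != t1 by move=> h; apply: contraNneq t1out => <-.
  apply: (mean_value_le (df := g2) (ltW xy)) => [|z /andP[xz zy]|z /andP[xz zy]].
  - apply: derivable_within_continuous => z; rewrite in_itv/= => /ne zt1.
    by have [] := gD z zt1.
  - by apply: gD; apply: ne; rewrite !ltW.
  - by apply: gM; [rewrite (lt_trans ax)//= (lt_trans zy)|apply: ne; rewrite !ltW].
have right x : a < t1 -> t1 < x -> x < b -> g1 x - l <= M * (x - t1).
  move=> at1 t1x xb; apply: (@le_trans _ _ (g1 x - r)); first by rewrite lerB.
  have lim1 : g1 x - g1 z @[z --> t1^'+] --> g1 x - r.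
    by apply: cvgB => //; exact: cvg_cst.
  have lim2 : M * (x - z) @[z --> t1^'+] --> M * (x - t1).
    by apply: cvgMr; apply: cvgB; [exact: cvg_cst|exact: cvg_at_right_filter].
  apply: (ler_cvg_to lim1 lim2); near=> z.
  apply: side => //.
  - by rewrite (lt_trans at1)//; near: z; exact: nbhs_right_gt.
  - by rewrite negb_and -ltNge; apply/orP; left; near: z; exact: nbhs_right_gt.
have left x : a < x -> x < t1 -> t1 < b -> l - g1 x <= M * (t1 - x).
  move=> ax xt1 t1b.
  have lim1 : g1 z - g1 x @[z --> t1^'-] --> l - g1 x.
    by apply: cvgB => //; exact: cvg_cst.
  have lim2 : M * (z - x) @[z --> t1^'-] --> M * (t1 - x).
    by apply: cvgMr; apply: cvgB; [exact: cvg_at_left_filter|exact: cvg_cst].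
  apply: (ler_cvg_to lim1 lim2); near=> z.
  apply: side => //.
  - by rewrite (lt_trans _ t1b)//; near: z; exact: nbhs_left_lt.
  - by rewrite negb_and -ltNge -ltNge; apply/orP; right; near: z; exact: nbhs_left_lt.
split=> [x y ax xy yb xt1 yt1|//].
have [/andP[]|t1out] := boolP (x <= t1 <= y); last exact: side.
move=> xt t1y; have {}xt : x < t1 by rewrite lt_neqAle xt1.
have {}t1y : t1 < y by rewrite lt_neqAle eq_sym yt1.
have := right y (lt_trans ax xt) t1y yb; have := left x ax xt (lt_trans t1y yb).
lra.
Unshelve. all: by end_near. Qed.

(** A downward kink is concave, so it does not spoil the upper bound that [g'' <= M]
gives on second differences. Subtracting from [g] the parabola with
slope [K] at [p] and second derivative [M] leaves a function that increases up
to [p] and decreases after it. *)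
Lemma second_difference_le g g1 g2 t1 l r M (p : R) e : 0 < e -> continuous g ->
  (forall x, x != t1 -> is_derive x 1 g (g1 x)) ->
  (forall x, x != t1 -> is_derive x 1 g1 (g2 x)) ->
  g1 x @[x --> t1^'-] --> l -> g1 x @[x --> t1^'+] --> r -> r <= l ->
  (forall x : R, p - e < x < p + e -> x != t1 -> g2 x <= M) ->
  g (p + e) - 2 * g p + g (p - e) <= M * e ^+ 2.
Proof.
move=> e0 gc gD g1D gl gr rl gM.
have [mid [right left]] := derive_increment_le g1D gl gr rl gM.
have [K [KR KL]] : exists K,
    (forall x : R, p < x < p + e -> x != t1 -> g1 x <= K + M * (x - p)) /\
    (forall x : R, p - e < x < p -> x != t1 -> K + M * (x - p) <= g1 x).
  (* K is the slope of g at p; at a kink, any value between r and l would do. *)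
  have [pt1|pt1] := eqVneq p t1.
    exists l; rewrite pt1; split=> x /andP[xl xr] _.
      have := right x; rewrite pt1 in right gM *; lra.
    have := left x; rewrite pt1; lra.
  exists (g1 p); split=> x /andP[xl xr] xt1.
    have := mid p x; rewrite xt1 pt1; lra.
  have := mid x p; rewrite xt1 pt1; lra.
pose q x := K * (x - p) + M / 2 * (x - p) ^+ 2.
have qD (x : R) : is_derive x 1 q (K + M * (x - p)).
  by apply: is_derive_eq; rewrite /GRing.scale/=; field.
pose u x := g x - q x.
pose u1 x := g1 x - (K + M * (x - p)).
have uc : continuous u.
  by move=> x; apply: cvgB; [exact: gc|exact: is_derive1_continuous (qD x)].
have uD x : x != t1 -> is_derive x 1 u (u1 x).
  by move=> /gD gx; exact: is_deriveB.
have R0 : u (p + e) - u p <= 0 * (p + e - p).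
  apply: (@mean_value_le_off _ u1 t1) => // [|x /andP[xl xr] xt1].
  - by rewrite lerDl ltW.
  - by have := KR x; rewrite /u1 xl xr xt1; lra.
have L0 : - u p - - u (p - e) <= 0 * (p - (p - e)).
  apply: (@mean_value_le_off (- u) (- u1) t1) => // [|||x /andP[xl xr] xt1].
  - by rewrite gerBl ltW.
  - by move=> x; apply: cvgN; exact: uc.
  - by move=> x _ /uD ?; exact: is_deriveN.
  - by have := KL x; rewrite fctE /u1 xl xr xt1; lra.
by move: R0 L0; rewrite /u /q; lra.
Qed.

(** The symmetric second difference quotient. Applied to a second primitive of a
continuous [f] it is the convolution of [f] with the triangle kernel supported
between [- e] and [e], that is, a twice differentiable regularisation of [f]. *)
Definition sdq g e t := (g (t + e) - 2 * g t + g (t - e)) / e ^+ 2.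

Lemma sdq_le g g1 g2 t1 l r M (p : R) e : 0 < e -> continuous g ->
  (forall x, x != t1 -> is_derive x 1 g (g1 x)) ->
  (forall x, x != t1 -> is_derive x 1 g1 (g2 x)) ->
  g1 x @[x --> t1^'-] --> l -> g1 x @[x --> t1^'+] --> r -> r <= l ->
  (forall x : R, p - e < x < p + e -> x != t1 -> g2 x <= M) ->
  sdq g e p <= M.
Proof.
move=> e0 gc gD g1D gl gr rl gM.
rewrite /sdq ler_pdivrMr ?exprn_gt0//.
exact: (second_difference_le e0 gc gD g1D gl gr rl gM).
Qed.

(** Only the upper estimate has a uniform counterpart ([sdq_le]): at a point where
[r < l] the quotients tend to minus infinity. *)
Lemma sdq_near_le g g1 g2 t1 l r (p : R) eps : 0 < eps -> continuous g ->
  (forall x, x != t1 -> is_derive x 1 g (g1 x)) ->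
  (forall x, x != t1 -> is_derive x 1 g1 (g2 x)) ->
  g1 x @[x --> t1^'-] --> l -> g1 x @[x --> t1^'+] --> r -> r <= l ->
  {for p, continuous g2} ->
  \forall n \near \oo, sdq g n.+1%:R^-1 p <= g2 p + eps.
Proof.
move=> eps0 gc gD g1D gl gr rl g2c.
have /nbhs_ballP[/= del del0 h] : \forall x \near p, g2 x <= g2 p + eps.
  by apply: (cvgr_le _ g2c); rewrite ltrDl.
near=> n; apply: (sdq_le _ gc gD g1D gl gr rl) => // x /andP[xl xr] _.
apply: h; rewrite /ball/= ltr_norml.
have : n.+1%:R^-1 < del :> R by near: n; exact: near_infty_natSinv_lt (PosNum del0).
by move: (n.+1%:R^-1 : R) xl xr => d xl xr ddel; apply/andP; split; lra.
Unshelve. all: by end_near. Qed.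

Lemma sdqN g e t : sdq (- g) e t = - sdq g e t.
Proof. by rewrite /sdq !fctE -[RHS]mulNr; congr (_ * _); ring. Qed.

Lemma abs_sdq_le g g1 g2 t1 M (p : R) e : 0 < e ->
  (forall x : R, is_derive x 1 g (g1 x)) -> continuous g1 ->
  (forall x, x != t1 -> is_derive x 1 g1 (g2 x)) ->
  (forall x, x != t1 -> `|g2 x| <= M) -> `|sdq g e p| <= M.
Proof.
move=> e0 gD g1c g1D gM.
have gc : continuous g by move=> x; exact: is_derive1_continuous (gD x).
rewrite ler_norml; apply/andP; split.
  rewrite lerNl -sdqN.
  apply: (@sdq_le _ (- g1) (- g2) t1 (- g1 t1) (- g1 t1) _ _ _ e0) => //.
  - by move=> x; apply: cvgN; exact: gc.
  - by move=> x /g1D ?; exact: is_deriveN.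
  - by apply: cvg_at_left_filter; apply: cvgN; exact: g1c.
  - by apply: cvg_at_right_filter; apply: cvgN; exact: g1c.
  - by move=> x _ /gM; rewrite ler_norml fctE lerNl => /andP[].
apply: (@sdq_le _ g1 g2 t1 (g1 t1) (g1 t1) _ _ _ e0) => //.
- by apply: cvg_at_left_filter; exact/g1c.
- by apply: cvg_at_right_filter; exact/g1c.
- by move=> x _ /gM; rewrite ler_norml => /andP[].
Qed.

Lemma sdq_cvg g g1 g2 t1 (p : R) :
  (forall x : R, is_derive x 1 g (g1 x)) -> continuous g1 ->
  (forall x, x != t1 -> is_derive x 1 g1 (g2 x)) ->
  {for p, continuous g2} ->
  sdq g n.+1%:R^-1 p @[n --> \oo] --> g2 p.
Proof.
move=> gD g1c g1D g2c.
have gc : continuous g by move=> x; exact: is_derive1_continuous (gD x).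
apply/cvgrPdist_le => /= eps eps0.
have up : \forall n \near \oo, sdq g n.+1%:R^-1 p <= g2 p + eps.
  apply: (@sdq_near_le _ g1 g2 t1 (g1 t1) (g1 t1) _ _ eps0) => //.
  - by apply: cvg_at_left_filter; exact/g1c.
  - by apply: cvg_at_right_filter; exact/g1c.
have lo : \forall n \near \oo, sdq (- g) n.+1%:R^-1 p <= (- g2) p + eps.
  apply: (@sdq_near_le _ (- g1) (- g2) t1 (- g1 t1) (- g1 t1) _ _ eps0) => //.
  - by move=> x; apply: cvgN; exact: gc.
  - by move=> x /g1D ?; exact: is_deriveN.
  - by apply: cvg_at_left_filter; apply: cvgN; exact: g1c.
  - by apply: cvg_at_right_filter; apply: cvgN; exact: g1c.
  - exact: cvgN.
near=> n; rewrite ler_norml.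
have : sdq g n.+1%:R^-1 p <= g2 p + eps by near: n.
have : sdq (- g) n.+1%:R^-1 p <= (- g2) p + eps by near: n.
rewrite sdqN fctE; lra.
Unshelve. all: by end_near. Qed.

Lemma sdq_continuous g e : continuous g -> continuous (sdq g e).
Proof.
move=> gc t; rewrite /sdq; apply: cvgMl.
have sh a : {for t, continuous (fun x => g (x + a))}.
  apply: (@continuous_comp _ _ _ (shift a) g); last exact: gc.
  by apply: cvgD; [exact: cvg_id|exact: cvg_cst].
apply: cvgD; last exact: sh.
by apply: cvgB; [exact: sh|apply: cvgMr; exact: gc].
Qed.

Lemma is_derive_sdq g g1 e t : (forall x : R, is_derive x 1 g (g1 x)) ->
  is_derive t 1 (sdq g e) (sdq g1 e t).
Proof.
move=> gD.
have sh a : is_derive t 1 (fun x => g (x + a)) (g1 (t + a)).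
  have := gD (t + a); move=> gta.
  by have := @is_derive1_comp _ g (shift a) t _ _ gta (is_derive_shift _ _ _);
    rewrite mulr1.
have := sh e; have := sh (- e); have := gD t => ? ? ?.
rewrite /sdq; move: (e ^- 2) => k.
by apply: is_derive_eq; rewrite /GRing.scale/=; ring.
Qed.

End RealCalculus.

(** * Primitives and bounds for the first derivative *)

Section Primitives.
Context {R : realType}.
Implicit Types f : R -> R.

(** Vanishing on the left makes [f] integrable on every left half-line. *)
Lemma half_line_primitive f : continuous f -> (forall x : R, x <= 0 -> f x = 0) ->
  exists P : R -> R, forall x : R, is_derive x 1 P (f x).
Proof.
move=> fc f0.
pose P (x : R) := (\int[@lebesgue_measure R]_(t in `]-oo, x]) f t)%R.
exists P => x.
have fi : (@lebesgue_measure R).-integrable `]-oo, x + 1] (EFin \o f).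
  have fi0 : (@lebesgue_measure R).-integrable `[0, x + 1] (EFin \o f).
    apply: continuous_compact_integrable; first exact: segment_compact.
    exact: continuous_subspaceT.
  rewrite integrable_mkcond//; rewrite integrable_mkcond// in fi0.
  rewrite (_ : _ \_ _ = (EFin \o f) \_ `[0, x + 1])//.
  apply/funext => y; rewrite !patchE !mem_setE !in_itv/=.
  case: (leP 0 y) => //= y0; case: ifP => // _.
  by rewrite f0// ltW.
have x1 : x < x + 1 by rewrite ltrDl.
have [PD P1] := continuous_FTC1 x1 fi (ltNyr _) (fc x).
by split; [exact: PD | rewrite -derive1E].
Qed.

(** The fundamental theorem of calculus gives a primitive on a half-line bounded
below. Splitting [f - f 0] into its parts on the two half-lines, and reflecting
the left one, yields a primitive on the whole line. *)
Lemma continuous_primitive f : continuous f ->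
  exists P : R -> R, forall x : R, is_derive x 1 P (f x).
Proof.
move=> fc.
have [||P PD] := @half_line_primitive (fun x => f (Num.max x 0) - f 0).
- move=> x; apply: cvgB; last exact: cvg_cst.
  apply: (@continuous_comp _ _ _ (fun x : R => Num.max x 0) f); last exact: fc.
  by apply: continuous_max; [exact: cvg_id|exact: cvg_cst].
- by move=> x x0; rewrite max_r// subrr.
have [||Q QD] := @half_line_primitive (fun x => f (Num.min (- x) 0) - f 0).
- move=> x; apply: cvgB; last exact: cvg_cst.
  apply: (@continuous_comp _ _ _ (fun x : R => Num.min (- x) 0) f);
    last exact: fc.
  by apply: continuous_min; [apply: cvgN; exact: cvg_id|exact: cvg_cst].
- by move=> x x0; rewrite min_r ?subrr// oppr_ge0.
exists (fun x => P x - Q (- x) + f 0 * x) => x.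
have Qx : is_derive x (1 : R) (fun y => Q (- y)) (- (f (Num.min x 0) - f 0)).
  have q := QD (- x); rewrite opprK in q.
  have n : is_derive x (1 : R) (fun y : R => - y) (-1) by apply: is_derive_eq.
  by have := @is_derive1_comp _ Q (fun y => - y) x _ _ q n; rewrite mulrN1.
have Px := PD x.
apply: is_derive_eq; rewrite /GRing.scale/=.
by case: (leP x 0) => x0; lra.
Qed.

(** The quantity [v = d u' - c u] has the bounded derivative [d u'' - c u'], and
[u'] is at most [2 B] at some point between [t] and [t + 1] by the mean value theorem;
comparing [v] at that point and at [t] bounds [u' t]. *)
Lemma derive1_bound (u u1 u2 : R -> R) (d c B K t : R) : 0 < d ->
  (forall x : R, is_derive x 1 u (u1 x)) -> (forall x : R, is_derive x 1 u1 (u2 x)) ->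
  (forall x, `|u x| <= B) -> (forall x, `|d * u2 x - c * u1 x| <= K) ->
  `|u1 t| <= (K + 2 * `|c| * B + 2 * d * B) / d.
Proof.
move=> d0 uD u1D uB kK.
have t1 : t < t + 1 by rewrite ltrDl.
have uc a b : {within `[a, b], continuous u}.
  by apply: continuous_subspaceT => x; exact: is_derive1_continuous (uD x).
have [z /= zt] := MVT t1 (fun x _ => uD x) (uc _ _).
rewrite addrAC subrr add0r mulr1 => uz.
move: zt; rewrite in_itv/= => /andP[tz zt].
pose v x := d * u1 x - c * u x.
have vD (x : R) : is_derive x 1 v (d * u2 x - c * u1 x).
  have ? := uD x; have ? := u1D x.
  by apply: is_derive_eq; rewrite /GRing.scale/=; ring.
have vc a b : {within `[a, b], continuous v}.
  by apply: continuous_subspaceT => x; exact: is_derive1_continuous (vD x).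
have [y _ vy] := MVT tz (fun x _ => vD x) (vc _ _).
have {}vy : `|v z - v t| <= K.
  rewrite vy normrM (le_trans (ler_wpM2r _ (kK y)))//.
  rewrite ger0_norm ?subr_ge0 ?(ltW tz)// ler_piMr//; last by lra.
  exact: le_trans (kK t).
rewrite ler_pdivlMr// mulrC -{1}(gtr0_norm d0) -normrM.
have -> : d * u1 t = - (v z - v t) + (d * (u (t + 1) - u t) - c * (u z - u t)).
  by rewrite uz /v; ring.
apply: (le_trans (ler_normD _ _)); rewrite normrN -[leRHS]addrA lerD//.
apply: (le_trans (ler_normB _ _)); rewrite !normrM (gtr0_norm d0).
have du a b : `|u a - u b| <= 2 * B.
  by apply: (le_trans (ler_normB _ _)); have := uB a; have := uB b; lra.
have := ler_wpM2l (ltW d0) (du (t + 1) t).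
have := ler_wpM2l (normr_ge0 c) (du z t).
lra.
Qed.

End Primitives.

(** * Column-valued functions *)

Section Columns.
Context {R : realType} {m : nat}.
Implicit Types (f g phi psi : R -> 'cV[R]_m) (i : 'I_m) (t e : R).

Lemma norm_entry_le (v : 'cV[R]_m) i : `|v i 0| <= `|v|.
Proof.
by rewrite [leRHS]/Num.Def.normr/= mx_normrE; exact: (le_bigmax _ _ (i, 0)).
Qed.

Lemma norm_col_le (v : 'cV[R]_m) (M : R) :
  0 <= M -> (forall i, `|v i 0| <= M) -> `|v| <= M.
Proof.
move=> M0 vM; rewrite [leLHS]/Num.Def.normr/= mx_normrE.
by apply: bigmax_le => // -[i j] _ /=; rewrite ord1.
Qed.

Lemma cvg_colP {T : Type} (F : set_system T) {FF : Filter F}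
    (f : T -> 'cV[R]_m) (l : 'cV[R]_m) :
  f x @[x --> F] --> l <-> forall i, f x i 0 @[x --> F] --> l i 0.
Proof.
split=> [fl i|fl].
  move/cvgrPdist_le : fl => fl; apply/cvgrPdist_le => e e0; move: (fl e e0).
  apply: (@filterS _ F FF) => x; apply: le_trans.
  by have := norm_entry_le (l - f x) i; rewrite !mxE.
apply/cvgrPdist_le => /= e e0.
have : \forall x \near F, forall i, `|l i 0 - f x i 0| <= e.
  by apply: filter_forall => i; move/cvgrPdist_le : (fl i); exact.
by apply: (@filterS _ F FF) => x h; apply: norm_col_le (ltW e0) _ => i; rewrite !mxE.
Qed.

Lemma is_derive_colP f t (l : 'cV[R]_m) :
  is_derive t (1 : R) f l <->
  forall i, is_derive t (1 : R) (fun x => f x i 0) (l i 0).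
Proof.
split=> [[fD <-] i|fD].
  split; first exact: (derivable_mxP f t 1).1.
  by rewrite derive_mx// !mxE.
have fd : derivable f t 1.
  by apply/derivable_mxP => i j; rewrite ord1; have [] := fD i.
split=> //; rewrite derive_mx//; apply/matrixP => i j; rewrite ord1 !mxE.
by have [_ ->] := fD i.
Qed.

Lemma CbP f : Cb f <-> (forall i, continuous (fun t => f t i 0)) /\
  exists M : R, forall t i, `|f t i 0| <= M.
Proof.
split=> [[fc [M fM]]|[fc [M fM]]].
  split=> [i t|]; first exact: (cvg_colP (fun x => f x) _).1 (fc t) i.
  by exists M => t i; exact: le_trans (norm_entry_le _ _) (fM t _).
split=> [t|]; first by apply/cvg_colP => i; exact: fc.
exists `|M| => t _; apply: norm_col_le => // i.
exact: le_trans (fM t i) (ler_norm _).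
Qed.

Lemma Cb_opp f : Cb f -> Cb (fun t => - f t).
Proof.
move=> /CbP[fc [M fM]]; apply/CbP; split=> [i t|].
  rewrite (_ : (fun t => (- f t) i 0) = (fun t => - (f t i 0))).
    by apply: cvgN; exact: fc.
  by apply/funext => x; rewrite mxE.
by exists M => t i; rewrite mxE normrN.
Qed.

Lemma Cb_add f g : Cb f -> Cb g -> Cb (fun t => f t + g t).
Proof.
move=> /CbP[fc [M fM]] /CbP[gc [N gN]]; apply/CbP; split=> [i t|].
  rewrite (_ : (fun t => (f t + g t) i 0) = (fun t => f t i 0 + g t i 0)).
    by apply: cvgD; [exact: fc|exact: gc].
  by apply/funext => x; rewrite mxE.
exists (M + N) => t i; rewrite mxE.
by apply: le_trans (ler_normD _ _) _; exact: lerD.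
Qed.

Lemma Cb_scale (a : R) f : Cb f -> Cb (fun t => a *: f t).
Proof.
move=> /CbP[fc [M fM]]; apply/CbP; split=> [i t|].
  rewrite (_ : (fun t => (a *: f t) i 0) = (fun t => a * f t i 0)).
    by apply: cvgMr; exact: fc.
  by apply/funext => x; rewrite mxE.
by exists (`|a| * M) => t i; rewrite mxE normrM ler_wpM2l.
Qed.

Lemma Cb_max f g : Cb f -> Cb g ->
  Cb (fun t => \col_i Num.max (f t i 0) (g t i 0)).
Proof.
move=> /CbP[fc [M fM]] /CbP[gc [N gN]]; apply/CbP; split=> [i t|].
  rewrite (_ : (fun t => _ i 0) = (fun t => Num.max (f t i 0) (g t i 0))).
    by apply: continuous_max; [exact: fc|exact: gc].
  by apply/funext => x; rewrite mxE.
exists (Num.max M N) => t i; rewrite mxE le_max.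
by case: (leP (f t i 0) (g t i 0)) => _; rewrite ?fM ?gN// orbT.
Qed.

Lemma Cb_cst (x : 'cV[R]_m) : Cb (cst x).
Proof. by split=> [t|]; [exact: cvg_cst|exists `|x|]. Qed.

Lemma Cb_shift (s : R) f : Cb f -> Cb (f \o shift s).
Proof.
move=> [fc [M fM]]; split=> [t|]; last by exists M => t _; exact: fM.
apply: continuous_comp; last exact: fc.
by apply: cvgD; [exact: cvg_id|exact: cvg_cst].
Qed.

(** The derivatives are parameters, instead of the total derivative functions, so
that the notion is stable under negation: nothing is known of the total
derivative at a kink. *)
Definition derivatives_on (A : set R) phi phi1 phi2 (M : R) : Prop :=
  forall t i, A t ->
  [/\ is_derive t (1 : R) (fun x => phi x i 0) (phi1 t i 0),
      is_derive t (1 : R) (fun x => phi1 x i 0) (phi2 t i 0),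
      {for t, continuous (fun x => phi2 x i 0)} &
      [/\ `|phi t i 0| <= M, `|phi1 t i 0| <= M & `|phi2 t i 0| <= M]].

Lemma derivatives_on_opp A phi phi1 phi2 M :
  derivatives_on A phi phi1 phi2 M ->
  derivatives_on A (fun t => - phi t) (fun t => - phi1 t) (fun t => - phi2 t) M.
Proof.
have oppE f i : (fun x => (- f x) i 0) = - (fun x => f x i 0).
  by apply/funext => x; rewrite mxE.
move=> phiD t i At; have [d1 d2 c2 [b0 b1 b2]] := phiD t i At.
rewrite !oppE !mxE !normrN; split=> //;
  [exact: is_deriveN|exact: is_deriveN|exact: continuousN].
Qed.

Lemma Cb2_onP A phi : Cb2_on A phi ->
  exists M, derivatives_on A phi phi^`()%classic phi^`(2)%classic M.
Proof.
move=> [D1 D2 C2 [[M0 b0] [M1 b1] [M2 b2]]].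
exists (Num.max M0 (Num.max M1 M2)) => t i At; split.
- apply: (is_derive_colP _ _ _).1 i; rewrite derive1E; exact: derivableP (D1 t At).
- apply: (is_derive_colP _ _ _).1 i; rewrite derive1nS derive1n1 derive1E.
  exact: derivableP (D2 t At).
- exact: (cvg_colP (fun x => phi^`(2)%classic x) _).1 (C2 t At) i.
- split; apply: le_trans (norm_entry_le _ _) _; rewrite !le_max.
  + by rewrite b0.
  + by rewrite b1// orbT.
  + by rewrite b2// !orbT.
Qed.

Lemma Cb2_intro phi phi1 phi2 :
  (forall t i, is_derive t (1 : R) (fun x => phi x i 0) (phi1 t i 0)) ->
  (forall t i, is_derive t (1 : R) (fun x => phi1 x i 0) (phi2 t i 0)) ->
  Cb phi -> Cb phi1 -> Cb phi2 ->
  [/\ Cb2 phi, phi^`()%classic = phi1 & phi^`(2)%classic = phi2].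
Proof.
move=> D1 D2 [c0 b0] [c1 b1] [c2 b2].
have d1 t : is_derive t (1 : R) phi (phi1 t) by apply/is_derive_colP.
have d2 t : is_derive t (1 : R) phi1 (phi2 t) by apply/is_derive_colP.
have e1 : phi^`()%classic = phi1.
  by apply/funext => t; rewrite derive1E; have [_ ->] := d1 t.
have e2 : phi^`(2)%classic = phi2.
  by apply/funext => t; rewrite derive1nS derive1n1 e1 derive1E; have [_ ->] := d2 t.
split=> //; split; rewrite ?e2 ?e1; [| | |by []] => t _.
- by have [] := d1 t.
- by have [] := d2 t.
- exact: c2.
Qed.

Lemma Cb2_Cb phi : Cb2 phi -> Cb phi.
Proof.
move=> /Cb2_onP[M h]; apply/CbP; split=> [i t|].
  by have [d1 _ _ _] := h t i I; exact: is_derive1_continuous d1.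
by exists M => t i; have [_ _ _ []] := h t i I.
Qed.

Lemma Cb2_shift (s : R) phi : Cb2 phi ->
  [/\ Cb2 (phi \o shift s),
      (phi \o shift s)^`()%classic = phi^`()%classic \o shift s &
      (phi \o shift s)^`(2)%classic = phi^`(2)%classic \o shift s].
Proof.
move=> phi2; have [M h] := Cb2_onP phi2.
have sh (g g1 : R -> R) t : (forall x : R, is_derive x (1 : R) g (g1 x)) ->
    is_derive t (1 : R) (fun x => g (x + s)) (g1 (t + s)).
  move=> gD; have gt := gD (t + s).
  by have := @is_derive1_comp _ g (shift s) t _ _ gt (is_derive_shift _ _ _);
    rewrite mulr1.
have phiC := Cb2_Cb phi2.
have phi1C : Cb phi^`()%classic.
  apply/CbP; split=> [i t|].
    by have [_ d2 _ _] := h t i I; exact: is_derive1_continuous d2.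
  by exists M => t i; have [_ _ _ []] := h t i I.
have phi2C : Cb phi^`(2)%classic.
  apply/CbP; split=> [i t|]; first by have [] := h t i I.
  by exists M => t i; have [_ _ _ []] := h t i I.
apply: Cb2_intro; try exact: Cb_shift.
- move=> t i; apply: (sh (fun x => phi x i 0) (fun x => phi^`()%classic x i 0)) => x.
  by have [] := h x i I.
- move=> t i; apply: (sh (fun x => phi^`()%classic x i 0)
    (fun x => phi^`(2)%classic x i 0)) => x.
  by have [] := h x i I.
Qed.

Lemma lin_opE (d : 'rV[R]_m) c L phi t i :
  lin_op d c L phi t i 0 = d 0 i * phi^`(2)%classic t i 0
    - c * phi^`()%classic t i 0 - L phi t i 0.
Proof. by rewrite /lin_op mul_diag_mx !mxE. Qed.

Lemma wave_opE (d : 'rV[R]_m) c F phi t i :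
  wave_op d c F phi t i 0 = d 0 i * phi^`(2)%classic t i 0
    - c * phi^`()%classic t i 0 + F phi t i 0.
Proof. by rewrite /wave_op mul_diag_mx !mxE. Qed.

End Columns.

(** * Convolution with a non-positive kernel *)

Section Convolution.
Context {R : realType} {m : nat} (N : R -> 'M[R]_m).
Hypothesis N_le0 : forall s, mxle (N s) 0.
Hypothesis N_int : forall f : R -> 'cV[R]_m, Cb f -> forall t i,
  (@lebesgue_measure R).-integrable setT
    (fun s => ((N (t - s) *m f s) i 0)%:E).
Implicit Types (f g h : R -> 'cV[R]_m).

Lemma kernel_mulmx_antimono (s : R) (x y : 'cV[R]_m) :
  mxle x y -> mxle (N s *m y) (N s *m x).
Proof.
move=> xy i j; rewrite !mxE; apply: ler_sum => k _; rewrite ler_wnM2l//.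
by have := N_le0 s i k; rewrite mxE.
Qed.

Lemma conv_op_antimono f g t : Cb f -> Cb g -> (forall s, mxle (f s) (g s)) ->
  mxle (conv_op N g t) (conv_op N f t).
Proof.
move=> fC gC fg i j; rewrite ord1 !mxE; apply: le_Rintegral => //.
- exact: N_int.
- exact: N_int.
- by move=> s _; exact: kernel_mulmx_antimono.
Qed.

Lemma conv_op_opp f t : Cb f ->
  conv_op N (fun s => - f s) t = - conv_op N f t.
Proof.
move=> fC; apply/matrixP => i j; rewrite !mxE -[RHS]mulN1r.
rewrite -RintegralZl//; last exact: N_int.
by apply: eq_Rintegral => s _; rewrite mulmxN mxE mulN1r.
Qed.

(** The half of the dominated convergence theorem that survives when [fn] is only
bounded from above: [max(fn, h)] is dominated and tends to [h] off [t1], and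
since the kernel is non-positive its convolution lies below that of [fn]. *)
Lemma conv_op_limsup (fn : nat -> R -> 'cV[R]_m) h t i (K : 'cV[R]_m)
    (v t1 : R) :
  (forall n, Cb (fn n)) -> Cb h -> (forall n s j, fn n s j 0 <= K j 0) ->
  (forall s, s != t1 -> forall j (eps : R), 0 < eps ->
     \forall n \near \oo, fn n s j 0 <= h s j 0 + eps) ->
  conv_op N (fn n) t i 0 @[n --> \oo] --> v ->
  conv_op N h t i 0 <= v.
Proof.
move=> fnC hC fnK fnh fnv.
pose g n s : 'cV[R]_m := \col_j Num.max (fn n s j 0) (h s j 0).
have gC n : Cb (g n) by exact: Cb_max.
have [_ [B hB]] := (CbP h).1 hC.
pose k : 'cV[R]_m := \col_j (`|K j 0| + B).
have gk n s j : `|g n s j 0| <= k j 0.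
  rewrite !mxE ler_norml; have := hB s j; rewrite ler_norml => /andP[h1 h2].
  have := fnK n s j; have := ler_norm (K j 0); have := normr_ge0 (K j 0) => *.
  apply/andP; split; first by rewrite le_max; apply/orP; right; lra.
  by rewrite ge_max; apply/andP; split; lra.
have gcvg : conv_op N (g n) t i 0 @[n --> \oo] --> conv_op N h t i 0.
  pose G n s := ((N (t - s) *m g n s) i 0)%:E.
  have [||||| _ _ cv] := @dominated_convergence _ _ R (@lebesgue_measure R) setT
    measurableT G (fun s => ((N (t - s) *m h s) i 0)%:E)
    (fun s => - ((N (t - s) *m k) i 0)%:E)%E.
  - by move=> n; exact: measurable_int (N_int (gC n) t i).
  - exact: measurable_int (N_int hC t i).
  - exists [set t1]; split => //; first exact: lebesgue_measure_set1.
    move=> s /= ns; apply: contrapT => st1; apply: ns => _.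
    have {}st1 : s != t1 by apply/eqP.
    apply: cvg_EFin; first by near=> n.
    rewrite /G/= mxE; under eq_fun do rewrite mxE.
    apply: cvg_big => [|j _]; first exact: add_continuous.
    apply: cvgMr; rewrite /g.
    under eq_fun do rewrite mxE.
    apply/cvgrPdist_le => eps eps0; near=> n.
    have : fn n s j 0 <= h s j 0 + eps by near: n; exact: fnh.
    rewrite distrC ger0_norm ?subr_ge0 ?le_max ?lexx ?orbT// => le1.
    by rewrite lerBlDl ge_max le1 lerDl ltW.
  - exact/integrableN/N_int/Cb_cst.
  - apply: aeW => s n _; rewrite -EFinN lee_fin !mxE -sumrN.
    rewrite (le_trans (ler_norm_sum _ _ _))// ler_sum// => j _.
    rewrite normrM -mulNr ler_pM//.
    by rewrite ler0_norm//; have := N_le0 (t - s) i j; rewrite mxE.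
  rewrite /conv_op mxE; under eq_fun do rewrite mxE.
  apply: fine_cvg; rewrite fineK; first exact: cv.
  by apply: integrable_fin_num => //; exact: N_int.
apply: (ler_cvg_to gcvg fnv); near=> n.
have := @conv_op_antimono (fn n) (g n) t (fnC n) (gC n); apply => s j j'.
by rewrite ord1 !mxE le_max lexx.
Unshelve. all: by end_near. Qed.

End Convolution.

(** * Comparison principle for the linear operator *)

Section LinearPart.
Context {R : realType} {m : nat}.
Variables (d : 'rV[R]_m) (c : R).
Variables (L : (R -> 'cV[R]_m) -> R -> 'cV[R]_m) (N : R -> 'M[R]_m).
Hypothesis d_gt0 : forall j, 0 < d 0 j.
Hypothesis L_Cb : forall phi, Cb phi -> Cb (L phi).
Hypothesis L_lin : linear_on_Cb L.
Hypothesis L_pcont : p_continuous L.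
Hypothesis L_trans : commutes_with_translations L.
Hypothesis N_le0 : forall s, mxle (N s) 0.
Hypothesis N_inv : inverse_integral_op d c L N.
Implicit Types (phi psi h : R -> 'cV[R]_m).

Lemma linear_on_Cb0 : L (cst 0) = cst 0.
Proof.
have := L_lin (-1) (Cb_cst 0) (Cb_cst 0).
rewrite (_ : (fun _ => _) = cst 0); last by apply/funext => t; rewrite scaler0 addr0.
by move=> ->; apply/funext => t; rewrite scaleN1r addNr.
Qed.

Lemma linear_on_CbZ a phi : Cb phi ->
  L (fun t => a *: phi t) = (fun t => a *: L phi t).
Proof.
move=> phiC; have := L_lin a phiC (Cb_cst 0); rewrite linear_on_Cb0.
under eq_fun do rewrite addr0.
by move=> ->; apply/funext => t; rewrite addr0.
Qed.

Lemma linear_on_CbN phi : Cb phi ->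
  L (fun t => - phi t) = (fun t => - L phi t).
Proof.
move=> phiC; have := linear_on_CbZ (-1) phiC.
under eq_fun do rewrite scaleN1r.
by move=> ->; apply/funext => t; rewrite scaleN1r.
Qed.

Lemma linear_on_CbB phi psi : Cb phi -> Cb psi ->
  L (fun t => phi t - psi t) = (fun t => L phi t - L psi t).
Proof.
move=> phiC psiC; have := L_lin (-1) psiC phiC.
under eq_fun do rewrite scaleN1r addrC.
by move=> ->; apply/funext => t; rewrite scaleN1r addrC.
Qed.

(** Otherwise there would be [phi n] bounded by [B] with [L (phi n)] exceeding [n + 1]
at some point; translating this point to the origin and dividing by
[n + 1] gives a sequence tending to [0] whose image stays above [1] at [0]. *)
Lemma p_continuous_bounded (B : R) : exists K : R, forall phi, Cb phi ->
  (forall t, `|phi t| <= B) -> forall t, `|L phi t| <= K.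
Proof.
apply: contrapT => /forallNP unb.
have /choice[phi_t phi_tP] : forall n : nat, exists p : (R -> 'cV[R]_m) * R,
    [/\ Cb p.1, forall t, `|p.1 t| <= B & n.+1%:R < `|L p.1 p.2|].
  move=> n; have := unb n.+1%:R; move=> /existsNP[phi] /not_implyP[phiC].
  move=> /not_implyP[phiB] /existsNP[t] /negP; rewrite -ltNge => ltn.
  by exists (phi, t).
pose zeta n s := n.+1%:R^-1 *: ((phi_t n).1 \o shift (phi_t n).2) s.
have shC n : Cb ((phi_t n).1 \o shift (phi_t n).2).
  by apply: Cb_shift; have [] := phi_tP n.
have zetaC n : Cb (zeta n) by exact/Cb_scale/shC.
have zetaB n t : `|zeta n t| <= n.+1%:R^-1 * B.
  rewrite normrZ ger0_norm// ler_wpM2l//.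
  by have [_ + _] := phi_tP n; exact.
have B0 : 0 <= B by have [_ + _] := phi_tP 0; move=> /(_ 0); exact: le_trans.
have invB : n.+1%:R^-1 * B @[n --> \oo] --> (0 : R).
  by rewrite -[X in _ --> X](mul0r B); apply: cvgMl; exact: cvg_harmonic.
have zeta0 t : zeta n t @[n --> \oo] --> (0 : 'cV[R]_m).
  apply/cvgrPdist_le => e e0; near=> n.
  rewrite sub0r normrN; apply: le_trans (zetaB n t) _.
  by near: n; apply: cvgr_le invB _ e0.
have zetaB' : exists B' : R, forall n t, `|zeta n t| <= B'.
  exists B => n t; apply: le_trans (zetaB n t) _.
  by rewrite ler_piMl// invf_le1// ler1n.
have := @L_pcont _ _ zetaC zetaB' (Cb_cst 0) zeta0 0.
rewrite linear_on_Cb0 => /cvgr0_norm_lt /(_ 1 ltr01).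
move=> [n0 _ /(_ n0 (leqnn _))]/=; apply/negP; rewrite -leNgt.
rewrite linear_on_CbZ// L_trans; last by have [] := phi_tP n0.
rewrite /= add0r normrZ ger0_norm// mulrC ler_pdivlMr// mul1r ltW//.
by have [_ _] := phi_tP n0.
Unshelve. all: by end_near. Qed.

Lemma lin_op_Cb phi : Cb2 phi -> Cb (lin_op d c L phi).
Proof.
move=> phi2; have phiC := Cb2_Cb phi2; have /CbP[Lc [K LK]] := L_Cb phiC.
have /Cb2_onP[M hM] := phi2; apply/CbP.
split=> [i t|].
  under eq_fun do rewrite lin_opE.
  apply: cvgB; last exact: Lc.
  have [_ d2 c2 _] := hM t i I.
  by apply: cvgB; apply: cvgMr; [exact: c2|exact: is_derive1_continuous d2].
exists (`|d| * M + `|c| * M + K) => t i; rewrite lin_opE.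
have [_ _ _ [_ b1 b2]] := hM t i I.
apply: le_trans (ler_normB _ _) _; rewrite lerD//.
apply: le_trans (ler_normB _ _) _; rewrite lerD// normrM.
  rewrite ler_pM//; rewrite [leRHS]/Num.Def.normr/= mx_normrE.
  exact: (le_bigmax _ _ (0, i)).
by rewrite ler_wpM2l.
Qed.

Lemma inverse_integral_integrable f : Cb f -> forall t i,
  (@lebesgue_measure R).-integrable setT
    (fun s => ((N (t - s) *m f s) i 0)%:E).
Proof. by case: N_inv => h _ _ _; exact: h. Qed.

(** The comparison principle for the linear operator, with a kink. In the sense of
distributions, [lin_op phi] is at most [h] plus a non-positive Dirac mass at
[t1], and convolution with [N <= 0] reverses the inequality. The distribution
is replaced by [lin_op (psi0 n)] for the regularisations [psi0 n] of [phi] by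
second difference quotients of a second primitive, which lie in [Cb2], so that
[N] inverts [lin_op] on them: these are bounded from above uniformly in [n], and
their upper limit off [t1] is at most [h]. *)
Lemma conv_op_le_kinked phi phi1 phi2 h (M t1 : R) (l r : 'cV[R]_m) :
  Cb phi -> Cb h -> derivatives_on (~` [set t1]) phi phi1 phi2 M ->
  (forall t i, t != t1 ->
     d 0 i * phi2 t i 0 - c * phi1 t i 0 - L phi t i 0 <= h t i 0) ->
  phi1 t @[t --> t1^'-] --> l -> phi1 t @[t --> t1^'+] --> r -> mxle r l ->
  forall t, mxle (conv_op N h t) (phi t).
Proof.
move=> phiC hC phiM phih phil phir rl t i j; rewrite ord1.
have [N_int N_Cb2 _ N_left] := N_inv.
have [phic [B phiB]] := (CbP phi).1 phiC.
have {}phiM s k : s != t1 -> _ := fun st1 => phiM s k (elimN eqP st1).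
(* First and second primitives of each entry of phi. *)
have /choice[P PD] := fun k => continuous_primitive (phic k).
have Pc k : continuous (P k).
  by move=> s; exact: is_derive1_continuous (PD k s).
have /choice[Q QD] := fun k => continuous_primitive (Pc k).
pose e n : R := n.+1%:R^-1.
have e0 n : 0 < e n by rewrite invr_gt0.
pose psi0 n s : 'cV[R]_m := \col_k sdq (Q k) (e n) s.
pose psi1 n s : 'cV[R]_m := \col_k sdq (P k) (e n) s.
pose psi2 n s : 'cV[R]_m := \col_k sdq (fun x => phi x k 0) (e n) s.
have psi0B n s k : `|psi0 n s k 0| <= B.
  rewrite mxE; apply: (abs_sdq_le (g2 := fun x => phi x k 0) (t1 := t1)
    _ (e0 n) (QD k) (Pc k)).
  by move=> x _; exact: phiB.
have psi1B n s k : `|psi1 n s k 0| <= M.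
  rewrite mxE; apply: (abs_sdq_le (g2 := fun x => phi1 x k 0) (t1 := t1)
    _ (e0 n) (PD k) (phic k)).
    by move=> x xt1; have [] := phiM x k xt1.
  by move=> x xt1; have [_ _ _ []] := phiM x k xt1.
have d01 n s k : is_derive s (1 : R) (fun x => psi0 n x k 0) (psi1 n s k 0).
  under eq_fun do rewrite mxE.
  by rewrite mxE; exact: is_derive_sdq.
have d12 n s k : is_derive s (1 : R) (fun x => psi1 n x k 0) (psi2 n s k 0).
  under eq_fun do rewrite mxE.
  by rewrite mxE; exact: (is_derive_sdq _ _ (PD k)).
have psi0C n : Cb (psi0 n).
  apply/CbP; split; last by exists B.
  by move=> k s; exact: is_derive1_continuous (d01 n s k).
have psi1C n : Cb (psi1 n).
  apply/CbP; split; last by exists M.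
  by move=> k s; exact: is_derive1_continuous (d12 n s k).
have psi2C n : Cb (psi2 n).
  apply/CbP; split=> [k|].
    under eq_fun do rewrite mxE.
    exact/sdq_continuous/phic.
  exists (4 * B / (e n) ^+ 2) => s k; rewrite mxE /sdq normrM.
  have e2 : 0 <= (e n ^+ 2)^-1 by rewrite invr_ge0 exprn_ge0// ltW.
  rewrite (ger0_norm e2) ler_wpM2r//.
  have := phiB (s + e n) k; have := phiB s k; have := phiB (s - e n) k.
  by rewrite !ler_norml => /andP[? ?] /andP[? ?] /andP[? ?]; apply/andP; lra.
have S n := Cb2_intro (d01 n) (d12 n) (psi0C n) (psi1C n) (psi2C n).
pose fn n := lin_op d c L (psi0 n).
have fnE n s k : fn n s k 0 = d 0 k * sdq (fun x => phi x k 0) (e n) s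
    - c * sdq (P k) (e n) s - L (psi0 n) s k 0.
  by have [_ e1 e2] := S n; rewrite lin_opE e1 e2 !mxE.
have psi0_cvg s k : psi0 n s k 0 @[n --> \oo] --> phi s k 0.
  under eq_fun do rewrite mxE.
  by apply: (sdq_cvg (g2 := fun x => phi x k 0) (t1 := t1) (QD k)) => //; exact: phic.
have psi0_norm n s : `|psi0 n s| <= B.
  by apply: norm_col_le => //; exact: le_trans (phiB 0 i).
have L_cvg s k : L (psi0 n) s k 0 @[n --> \oo] --> L phi s k 0.
  apply: (cvg_colP (fun n => L (psi0 n) s) _).1.
  apply: L_pcont => //; first by exists B.
  by move=> x; apply/cvg_colP => k'; exact: psi0_cvg.
have [K LK] := p_continuous_bounded B.
apply: (@conv_op_limsup _ _ _ N_le0 N_int fn h t i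
  (\col_k (d 0 k * M + `|c| * M + K)) _ t1) => //.
- by move=> n; apply: lin_op_Cb; have [] := S n.
- move=> n s k; rewrite fnE !mxE lerD//; last first.
    rewrite lerNl.
    have := le_trans (norm_entry_le _ k) (LK _ (psi0C n) (psi0_norm n) s).
    by rewrite ler_norml => /andP[].
  rewrite lerD//.
    rewrite ler_pM2l//.
    apply: (sdq_le (g1 := fun x => phi1 x k 0)
      (g2 := fun x => phi2 x k 0) (t1 := t1) (l := l k 0) (r := r k 0) (e0 n) (phic k)).
    + by move=> x xt1; have [] := phiM x k xt1.
    + by move=> x xt1; have [] := phiM x k xt1.
    + exact: (cvg_colP (fun x => phi1 x) _).1 phil k.
    + exact: (cvg_colP (fun x => phi1 x) _).1 phir k.
    + exact: rl.
    + move=> x _ xt1; have [_ _ _ [_ _]] := phiM x k xt1.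
      by rewrite ler_norml => /andP[].
  apply: le_trans (ler_norm _) _; rewrite normrN normrM ler_wpM2l//.
  by have := psi1B n s k; rewrite mxE.
- move=> s st1 k eps eps0.
  have eps2 : 0 < eps / 2 by rewrite divr_gt0.
  have A1 : \forall n \near \oo, sdq (fun x => phi x k 0) (e n) s <=
      phi2 s k 0 + eps / 2 / d 0 k.
    apply: (sdq_near_le (g1 := fun x => phi1 x k 0)
      (g2 := fun x => phi2 x k 0) (t1 := t1) (l := l k 0) (r := r k 0) _ (phic k)).
    + by rewrite divr_gt0.
    + by move=> x xt1; have [] := phiM x k xt1.
    + by move=> x xt1; have [] := phiM x k xt1.
    + exact: (cvg_colP (fun x => phi1 x) _).1 phil k.
    + exact: (cvg_colP (fun x => phi1 x) _).1 phir k.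
    + exact: rl.
    + by have [] := phiM s k st1.
  have A2 : - c * sdq (P k) (e n) s - L (psi0 n) s k 0 @[n --> \oo] -->
      - c * phi1 s k 0 - L phi s k 0.
    apply: cvgB; last exact: L_cvg.
    apply: cvgMr; apply: (sdq_cvg (g2 := fun x => phi1 x k 0) (t1 := t1)
      (PD k) (phic k)).
      by move=> x xt1; have [] := phiM x k xt1.
    by have [_ d2 _ _] := phiM s k st1; exact: is_derive1_continuous d2.
  have A3 : \forall n \near \oo, - c * sdq (P k) (e n) s - L (psi0 n) s k 0 <=
      - c * phi1 s k 0 - L phi s k 0 + eps / 2.
    by apply: cvgr_le A2 _ _; rewrite ltrDl.
  near=> n; rewrite fnE.
  have B1 : sdq (fun x => phi x k 0) (e n) s <=
      phi2 s k 0 + eps / 2 / d 0 k by near: n.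
  have B3 : - c * sdq (P k) (e n) s - L (psi0 n) s k 0 <=
      - c * phi1 s k 0 - L phi s k 0 + eps / 2 by near: n.
  have B4 := phih s k st1.
  have : d 0 k * sdq (fun x => phi x k 0) (e n) s <=
      d 0 k * phi2 s k 0 + eps / 2.
    apply: le_trans (ler_wpM2l (ltW (d_gt0 k)) B1) _.
    by rewrite mulrDr mulrC [X in _ + X]mulrC divfK ?gt_eqF// mulrC.
  lra.
- have := psi0_cvg t i.
  rewrite (_ : (fun n => psi0 n t i 0) = (fun n => conv_op N (fn n) t i 0))//.
  by apply/funext => n; rewrite N_left//; have [] := S n.
Unshelve. all: by end_near. Qed.

End LinearPart.

(** * The monotone iteration *)

Section MonotoneIteration.
Context {R : realType} {m : nat}.
Variables (d : 'rV[R]_m) (c : R).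
Variables (F L : (R -> 'cV[R]_m) -> R -> 'cV[R]_m) (N : R -> 'M[R]_m).
Hypothesis d_gt0 : forall j, 0 < d 0 j.
Hypothesis F_Cb : forall phi, Cb phi -> Cb (F phi).
Hypothesis F_pcont : p_continuous F.
Hypothesis L_Cb : forall phi, Cb phi -> Cb (L phi).
Hypothesis L_lin : linear_on_Cb L.
Hypothesis L_pcont : p_continuous L.
Hypothesis N_le0 : forall s, mxle (N s) 0.
Hypothesis N_inv : inverse_integral_op d c L N.
Hypothesis FL_mono : forall phi psi, Cb phi -> Cb psi ->
  (forall t, mxle (phi t) (psi t)) ->
  forall t, mxle 0 (F psi t - F phi t + L (fun s => psi s - phi s) t).
Hypothesis L_trans : commutes_with_translations L.
Hypothesis F_trans : commutes_with_translations F.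
Implicit Types (f phi psi : R -> 'cV[R]_m).

(** The order-preserving operator of hypothesis (a). *)
Definition reaction phi s := F phi s + L phi s.
Definition picard phi t := - conv_op N (reaction phi) t.

Let N_int := inverse_integral_integrable N_inv.

Lemma iteratesS phi n :
  iterates N F L phi n.+1 = picard (iterates N F L phi n).
Proof. by []. Qed.

Lemma reaction_Cb phi : Cb phi -> Cb (reaction phi).
Proof. by move=> phiC; apply: Cb_add; [exact: F_Cb|exact: L_Cb]. Qed.

Lemma reaction_le phi psi : Cb phi -> Cb psi ->
  (forall t, mxle (phi t) (psi t)) ->
  forall t, mxle (reaction phi t) (reaction psi t).
Proof.
move=> phiC psiC le t i j; have := FL_mono phiC psiC le t i j.
by rewrite linear_on_CbB// /reaction !mxE; lra.
Qed.

Lemma reaction_shift (s : R) phi : Cb phi ->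
  reaction (phi \o shift s) = reaction phi \o shift s.
Proof. by move=> phiC; apply/funext => t; rewrite /reaction F_trans// L_trans. Qed.

Lemma reaction_cvg (zeta : nat -> R -> 'cV[R]_m) phi :
  (forall n, Cb (zeta n)) -> (exists M : R, forall n t, `|zeta n t| <= M) ->
  Cb phi -> (forall t, zeta n t @[n --> \oo] --> phi t) ->
  forall t i, reaction (zeta n) t i 0 @[n --> \oo] --> reaction phi t i 0.
Proof.
move=> zC zB phiC zphi t.
apply/(cvg_colP (fun n => reaction (zeta n) t)).
by apply: cvgD; [exact: F_pcont|exact: L_pcont].
Qed.

(** No change of variables in the integral is needed: a translate of [conv_op N f]
is the only preimage in [Cb2] of the translate of [f] under [lin_op]. *)
Lemma conv_op_shift (s : R) f : Cb f ->
  conv_op N (f \o shift s) = conv_op N f \o shift s.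
Proof.
move=> fC; have [_ N_Cb2 N_right N_left] := N_inv.
have [g2 e1 e2] := Cb2_shift s (N_Cb2 f fC).
have IC := Cb2_Cb (N_Cb2 f fC).
have <- : lin_op d c L (conv_op N f \o shift s) = f \o shift s.
  apply/funext => t; rewrite /lin_op e1 e2 (L_trans s IC) /=.
  exact: (congr1 (fun g : R -> 'cV[R]_m => g (t + s)) (N_right f fC)).
exact: N_left.
Qed.

Lemma picard_Cb2 phi : Cb phi -> Cb2 (picard phi) /\
  lin_op d c L (picard phi) = (fun t => - reaction phi t).
Proof.
move=> phiC; have [_ N_Cb2 N_right _] := N_inv.
have AC := reaction_Cb phiC.
have -> : picard phi = conv_op N (fun t => - reaction phi t).
  by apply/funext => t; rewrite conv_op_opp.
by split; [apply: N_Cb2|apply: N_right]; exact: Cb_opp.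
Qed.

Lemma picard_Cb phi : Cb phi -> Cb (picard phi).
Proof. by move=> /picard_Cb2[/Cb2_Cb]. Qed.

Lemma picard_le phi psi : Cb phi -> Cb psi ->
  (forall t, mxle (phi t) (psi t)) ->
  forall t, mxle (picard phi t) (picard psi t).
Proof.
move=> phiC psiC le t i j; rewrite /picard [leLHS]mxE [leRHS]mxE lerN2.
apply: conv_op_antimono => //; try exact: reaction_Cb.
exact: reaction_le.
Qed.

Lemma picard_shift (s : R) phi : Cb phi ->
  picard (phi \o shift s) = picard phi \o shift s.
Proof.
move=> phiC; apply/funext => t.
by rewrite /picard (reaction_shift s phiC) (conv_op_shift s (reaction_Cb phiC)).
Qed.

Lemma picard_nondecreasing phi : Cb phi ->
  nondecreasing_vec phi -> nondecreasing_vec (picard phi).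
Proof.
move=> phiC phind s t st.
have -> : picard phi t = picard (phi \o shift (t - s)) s.
  by rewrite picard_shift//= addrC subrK.
apply: picard_le => //; first exact: Cb_shift.
by move=> x; apply: phind; rewrite /= lerDl subr_ge0.
Qed.

Lemma picard_fixpoint_wave phi : Cb phi -> picard phi = phi ->
  Cb2 phi /\ forall t, wave_op d c F phi t = 0.
Proof.
move=> phiC fix_phi; have [] := picard_Cb2 phiC; rewrite fix_phi => phi2 lin.
split=> // t; have := congr1 (@^~ t) lin.
rewrite /lin_op /wave_op /reaction /= => /eqP; rewrite subr_eq => /eqP ->.
by rewrite opprD subrK addNr.
Qed.

Lemma super_solution_picard_le phi phi1 phi2 (M t1 : R) (l r : 'cV[R]_m) :
  Cb phi -> derivatives_on (~` [set t1]) phi phi1 phi2 M ->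
  (forall t i, t != t1 ->
     d 0 i * phi2 t i 0 - c * phi1 t i 0 + F phi t i 0 <= 0) ->
  phi1 t @[t --> t1^'-] --> l -> phi1 t @[t --> t1^'+] --> r -> mxle r l ->
  forall t, mxle (picard phi t) (phi t).
Proof.
move=> phiC phiM phiF phil phir rl t; have AC := reaction_Cb phiC.
rewrite /picard -conv_op_opp//.
apply: (conv_op_le_kinked d_gt0 L_Cb L_lin L_pcont L_trans N_le0 N_inv phiC
  (Cb_opp AC) phiM _ phil phir rl) => s i /(phiF s i).
by rewrite /reaction !mxE; lra.
Qed.

Lemma sub_solution_le_picard phi phi1 phi2 (M t1 : R) (l r : 'cV[R]_m) :
  Cb phi -> derivatives_on (~` [set t1]) phi phi1 phi2 M ->
  (forall t i, t != t1 ->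
     0 <= d 0 i * phi2 t i 0 - c * phi1 t i 0 + F phi t i 0) ->
  phi1 t @[t --> t1^'-] --> l -> phi1 t @[t --> t1^'+] --> r -> mxle l r ->
  forall t, mxle (phi t) (picard phi t).
Proof.
move=> phiC phiM phiF phil phir lr t i j; have AC := reaction_Cb phiC.
rewrite -lerN2 [X in _ <= X](_ : _ = (- phi t) i j); last by rewrite [RHS]mxE.
rewrite /picard [X in - X <= _]mxE opprK.
apply: (conv_op_le_kinked d_gt0 L_Cb L_lin L_pcont L_trans N_le0 N_inv
  (Cb_opp phiC) AC (derivatives_on_opp phiM) _ (l := - l) (r := - r)).
- move=> s k /(phiF s k).
  by rewrite linear_on_CbN// /reaction !mxE; lra.
- exact: cvgN.
- exact: cvgN.
- by move=> k k'; rewrite !mxE lerN2.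
Qed.

(** The upper-limit lemma for convolutions, applied to [reaction (zeta n)] and to its
opposite, gives the two inequalities. The bounds [a] and [b] serve only to bound
[reaction (zeta n)], by monotonicity. *)
Lemma picard_limit (zeta : nat -> R -> 'cV[R]_m) phi a b :
  Cb a -> Cb b -> (forall n, Cb (zeta n)) -> Cb phi ->
  (forall n t, mxle (a t) (zeta n t)) -> (forall n t, mxle (zeta n t) (b t)) ->
  (forall t, zeta n t @[n --> \oo] --> phi t) ->
  (forall t, picard (zeta n) t @[n --> \oo] --> phi t) ->
  picard phi = phi.
Proof.
move=> aC bC zC phiC az zb zphi pphi.
have [_ [Ba aB]] := (CbP a).1 aC; have [_ [Bb bB]] := (CbP b).1 bC.
have zB : exists M : R, forall n t, `|zeta n t| <= M.
  exists (`|Ba| + `|Bb|) => n t; apply: norm_col_le => [|i]; first by rewrite addr_ge0.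
  exact: norm_le_between (az n t i 0) (zb n t i 0) (aB t i) (bB t i).
have rcv := reaction_cvg zC zB phiC zphi.
have raC := reaction_Cb aC; have rbC := reaction_Cb bC.
have [_ [Ka aK]] := (CbP _).1 raC; have [_ [Kb bK]] := (CbP _).1 rbC.
have rzC n := reaction_Cb (zC n); have rC := reaction_Cb phiC.
apply/funext => t; apply/matrixP => i j; rewrite ord1.
have pcv : picard (zeta n) t i 0 @[n --> \oo] --> phi t i 0.
  exact: (cvg_colP (fun n => picard (zeta n) t) _).1 (pphi t) i.
apply/eqP; rewrite eq_le; apply/andP; split.
  rewrite /picard -conv_op_opp//.
  apply: (@conv_op_limsup _ _ _ N_le0 N_int
    (fun n s => - reaction (zeta n) s) _ t i (const_mx Ka) _ 0) => //.
  - by move=> n; exact: Cb_opp.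
  - exact: Cb_opp.
  - move=> n s k.
    have := reaction_le aC (zC n) (az n) s k 0; have := aK s k.
    by rewrite /reaction !mxE ler_norml => /andP[? ?] ?; lra.
  - move=> s _ k eps eps0.
    have lim : - reaction (zeta n) s k 0 @[n --> \oo] --> - reaction phi s k 0.
      exact: (cvgN (rcv s k)).
    have : \forall n \near \oo,
        - reaction (zeta n) s k 0 <= - reaction phi s k 0 + eps.
      by apply: cvgr_le lim _ _; rewrite ltrDl.
    by apply: filterS => n; rewrite /reaction !mxE.
  - rewrite (_ : (fun n => _) = (fun n => picard (zeta n) t i 0))//.
    by apply/funext => n; rewrite conv_op_opp.
rewrite [leRHS]mxE lerNr.
apply: (@conv_op_limsup _ _ _ N_le0 N_int
  (fun n s => reaction (zeta n) s) _ t i (const_mx Kb) _ 0) => //.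
- move=> n s k.
  have := reaction_le (zC n) bC (zb n) s k 0; have := bK s k.
  by rewrite /reaction !mxE ler_norml => /andP[? ?] ?; lra.
- move=> s _ k eps eps0.
  by apply: cvgr_le (rcv s k) _ _; rewrite ltrDl.
- rewrite (_ : (fun n => _) = (fun n => - picard (zeta n) t i 0)).
    exact: cvgN.
  by apply/funext => n; rewrite [in RHS]mxE opprK.
Qed.

(** The image [u] of [phi] solves [d u'' - c u' = L u - reaction phi], whose right-hand
side is bounded uniformly in [phi]; hence so is [u']. *)
Lemma picard_equilipschitz a b : Cb a -> Cb b ->
  exists2 K : R, 0 <= K & forall phi, Cb phi ->
    (forall t, mxle (a t) (phi t)) -> (forall t, mxle (phi t) (b t)) ->
    (forall t, mxle (a t) (picard phi t)) -> (forall t, mxle (picard phi t) (b t)) ->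
    forall s t i, `|picard phi s i 0 - picard phi t i 0| <= K * `|s - t|.
Proof.
move=> aC bC.
have [_ [Ba aB]] := (CbP a).1 aC; have [_ [Bb bB]] := (CbP b).1 bC.
have [_ [Ka aK]] := (CbP _).1 (reaction_Cb aC).
have [_ [Kb bK]] := (CbP _).1 (reaction_Cb bC).
have [KL LK] := p_continuous_bounded L_lin L_pcont L_trans (`|Ba| + `|Bb|).
pose B := `|Ba| + `|Bb|; pose K := KL + (`|Ka| + `|Kb|).
pose C i := (K + 2 * `|c| * B + 2 * d 0 i * B) / d 0 i.
exists (\sum_i `|C i|); first exact: sumr_ge0.
move=> phi phiC aphi phib apic picb s t i.
have [/Cb2_onP[M h] lin] := picard_Cb2 phiC.
have picB x k : `|picard phi x k 0| <= B.
  exact: norm_le_between (apic x k 0) (picb x k 0) (aB x k) (bB x k).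
have picN x : `|picard phi x| <= B.
  by apply: norm_col_le => //; rewrite addr_ge0.
have kK x k : `|d 0 k * (picard phi)^`(2)%classic x k 0
    - c * (picard phi)^`()%classic x k 0| <= K.
  have := congr1 (fun g : R -> 'cV[R]_m => g x k 0) lin.
  rewrite lin_opE => /eqP; rewrite subr_eq => /eqP ->.
  rewrite mxE addrC; apply: le_trans (ler_normB _ _) _; apply: lerD.
    exact: le_trans (norm_entry_le _ _) (LK _ (picard_Cb phiC) picN x).
  apply: norm_le_between _ _ (aK x k) (bK x k); exact: reaction_le.
have D1 x : is_derive x (1 : R) (fun y => picard phi y i 0)
    ((picard phi)^`()%classic x i 0) by have [] := h x i I.
have D2 x : is_derive x (1 : R) (fun y => (picard phi)^`()%classic y i 0)
    ((picard phi)^`(2)%classic x i 0) by have [] := h x i I.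
have C1 x : `|(picard phi)^`()%classic x i 0| <= \sum_k `|C k|.
  apply: (@le_trans _ _ (C i)).
    exact: (derive1_bound x (d_gt0 i) D1 D2 (fun y => picB y i) (fun y => kK y i)).
  apply: le_trans (ler_norm _) _.
  by rewrite (bigD1 i)//= lerDl sumr_ge0.
wlog st : s t / s <= t => [hw|].
  by have [/hw//|/ltW/hw] := leP s t; rewrite distrC [X in _ * X]distrC.
have cont : {within `[s, t], continuous (fun y => picard phi y i 0)}.
  by apply: continuous_subspaceT => x; exact: is_derive1_continuous (D1 x).
have [x _ e] := MVT_segment st (fun x _ => D1 x) cont.
by rewrite distrC e normrM [X in _ * X]distrC ler_wpM2r.
Qed.

Lemma iterates_between a b : Cb a -> Cb b -> (forall t, mxle (a t) (b t)) ->
  (forall t, mxle (a t) (picard a t)) -> (forall t, mxle (picard b t) (b t)) ->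
  forall n, let phi := iterates N F L b in
  [/\ Cb (phi n), forall t, mxle (a t) (phi n t), forall t, mxle (phi n t) (b t) &
      forall t, mxle (phi n.+1 t) (phi n t)].
Proof.
move=> aC bC ab aT Tb; elim=> [|n [phiC aphi phib phiS]]; first by split=> // t i j.
have phiSC := picard_Cb phiC.
split; first exact: phiSC.
all: move=> t i j.
- by apply: le_trans (aT t i j) _; exact: picard_le.
- exact: le_trans (phiS t i j) (phib t i j).
- by rewrite !iteratesS; exact: picard_le.
Qed.

(** Pointwise monotone limits of continuous functions need not be continuous, while
p-continuity speaks of continuous limits only; the uniform Lipschitz bound
closes this gap. *)
Lemma iterates_cvg_fixpoint a b : Cb a -> Cb b -> (forall t, mxle (a t) (b t)) ->
  (forall t, mxle (a t) (picard a t)) -> (forall t, mxle (picard b t) (b t)) ->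
  exists phis : R -> 'cV[R]_m,
  [/\ Cb phis, picard phis = phis, forall t, mxle (a t) (phis t),
      forall t, mxle (phis t) (b t) &
      forall t, iterates N F L b n t @[n --> \oo] --> phis t].
Proof.
move=> aC bC ab aT Tb; have bt := iterates_between aC bC ab aT Tb.
pose phi := iterates N F L b.
pose phis t : 'cV[R]_m := \col_i limn (fun n => phi n t i 0).
have phi_cvg t i : phi n t i 0 @[n --> \oo] --> phis t i 0.
  rewrite mxE; apply: nonincreasing_is_cvgn.
    by apply/nonincreasing_seqP => n; have [_ _ _] := bt n; exact.
  by exists (a t i 0) => _ [n _ <-]; have [_ + _ _] := bt n; exact.
have aphis t : mxle (a t) (phis t).
  move=> i j; rewrite ord1; apply: ler_cvg_to (cvg_cst _) (phi_cvg t i) _.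
  by apply: nearW => n; have [_ + _ _] := bt n; exact.
have phisb t : mxle (phis t) (b t).
  move=> i j; rewrite ord1; apply: ler_cvg_to (phi_cvg t i) (cvg_cst _) _.
  by apply: nearW => n; have [_ _ + _] := bt n; exact.
have [K K0 lip] := picard_equilipschitz aC bC.
have phis_lip s t i : `|phis s i 0 - phis t i 0| <= K * `|s - t|.
  have cv : `|phi n.+1 s i 0 - phi n.+1 t i 0| @[n --> \oo] -->
      `|phis s i 0 - phis t i 0|.
    apply: cvg_norm; apply: cvgB.
      by rewrite (cvg_shiftS (fun n => phi n s i 0)).
    by rewrite (cvg_shiftS (fun n => phi n t i 0)).
  apply: ler_cvg_to cv (cvg_cst _) _; apply: nearW => n.
  have [phiC a1 b1 _] := bt n; have [_ a2 b2 _] := bt n.+1.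
  exact: lip.
have phisC : Cb phis.
  have [_ [Ba aB]] := (CbP a).1 aC; have [_ [Bb bB]] := (CbP b).1 bC.
  apply/CbP; split=> [i t|].
    apply/cvgrPdist_le => e e0.
    have e1 : 0 < e / (K + 1) by rewrite divr_gt0// ltr_wpDl.
    near=> s; apply: le_trans (phis_lip t s i) _.
    have : `|t - s| <= e / (K + 1) by near: s; exact: cvgr_dist_le.
    rewrite ler_pdivlMr ?ltr_wpDl// => le1.
    apply: le_trans le1; rewrite mulrC ler_wpM2l//; lra.
  exists (`|Ba| + `|Bb|) => t i.
  exact: norm_le_between (aphis t i 0) (phisb t i 0) (aB t i) (bB t i).
have phi_cvgv t : phi n t @[n --> \oo] --> phis t.
  by apply/cvg_colP => i; exact: phi_cvg.
exists phis; split=> //.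
apply: (picard_limit aC bC (zeta := phi)) => //.
- by move=> n; have [] := bt n.
- by move=> n; have [] := bt n.
- by move=> n; have [] := bt n.
- move=> t; rewrite (_ : (fun n => _) = (fun n => phi n.+1 t))//.
  by rewrite (cvg_shiftS (fun n => phi n t)).
Unshelve. all: by end_near. Qed.

(** The translates of [phi] by [n] are again fixed points and tend to the constant
[x], which is therefore a fixed point, that is, a constant solution. *)
Lemma fixpoint_limit_is_zero phi (x a b : 'cV[R]_m) : Cb phi -> picard phi = phi ->
  (forall t, mxle a (phi t)) -> (forall t, mxle (phi t) b) ->
  phi t @[t --> +oo] --> x -> on_constants F x = 0.
Proof.
move=> phiC fix_phi aphi phib phix.
have sh_cvg t : (phi \o shift n%:R) t @[n --> \oo] --> x.
  apply: (cvg_comp (fun n : nat => t + n%:R) phi) phix.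
  exact: (cvg_comp (fun n : nat => n%:R) (fun r => t + r) (@cvgr_idn R) (cvg_addrl t)).
have fix_x : picard (cst x) = cst x.
  apply: (picard_limit (Cb_cst a) (Cb_cst b) (zeta := fun n => phi \o shift n%:R)).
  - by move=> n; exact: Cb_shift.
  - exact: Cb_cst.
  - by move=> n t; exact: aphi.
  - by move=> n t; exact: phib.
  - exact: sh_cvg.
  - move=> t; rewrite (_ : (fun n => _) = (fun n => (phi \o shift n%:R) t)).
      exact: sh_cvg.
    by apply/funext => n; rewrite (picard_shift _ phiC) fix_phi.
have [_ /(_ 0)] := picard_fixpoint_wave (Cb_cst x) fix_x.
have z1 : (cst x : R -> 'cV[R]_m)^`()%classic = cst 0.
  by apply/funext => t; exact: derive1_cst.
have z2 : (cst x : R -> 'cV[R]_m)^`(2)%classic = cst 0.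
  by rewrite derive1nS derive1n1 z1; apply/funext => t; exact: derive1_cst.
by rewrite /wave_op z1 z2 /= mulmx0 scaler0 subr0 add0r.
Qed.

End MonotoneIteration.

(** * Limits of monotone profiles and the theorem *)

Section Profiles.
Context {R : realType} {m : nat}.
Implicit Types (phi psi : R -> 'cV[R]_m).

Lemma nondecreasing_vec_le_limit phi (x : 'cV[R]_m) :
  nondecreasing_vec phi -> phi t @[t --> +oo] --> x -> forall t, mxle (phi t) x.
Proof.
move=> phind phix t i j; rewrite ord1.
apply: ler_cvg_to (cvg_cst _) ((cvg_colP phi _).1 phix i) _.
by near=> s; apply: phind; near: s; apply: nbhs_pinfty_ge; exact: num_real.
Unshelve. all: by end_near. Qed.

Lemma nondecreasing_vec_cvg phi (b : 'cV[R]_m) :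
  nondecreasing_vec phi -> (forall t, mxle (phi t) b) ->
  exists x : 'cV[R]_m, phi t @[t --> +oo] --> x.
Proof.
move=> phind phib; exists (\col_i sup (range (fun t => phi t i 0))).
apply/cvg_colP => i; rewrite mxE; apply: nondecreasing_cvgr.
  by move=> s t st; exact: (phind s t st).
by exists (b i 0) => _ [t _ <-]; exact: phib.
Qed.

End Profiles.

Theorem theorem3 (R : realType) (m : nat) (d : 'rV[R]_m) (c : R)
    (u2 : 'cV[R]_m)
    (F L : (R -> 'cV[R]_m) -> (R -> 'cV[R]_m))
    (N : R -> 'M[R]_m)
    (phim phip : R -> 'cV[R]_m)
    (m_gt0 : (0 < m)%N)
    (d_gt0 : forall j, 0 < d 0 j)
    (u2_gt0 : forall j, 0 < u2 j 0)
    (F_Cb : forall phi, Cb phi -> Cb (F phi))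
    (F_pcont : p_continuous F)
    (F_zeros : [set x : 'cV[R]_m | [/\ mxle 0 x, mxle x u2 &
                                      on_constants F x = 0]] = [set 0; u2])
    (L_Cb : forall phi, Cb phi -> Cb (L phi))
    (L_lin : linear_on_Cb L)
    (L_pcont : p_continuous L)
    (N_cont : continuous N)
    (N_le0 : forall s, mxle (N s) 0)
    (N_inv : inverse_integral_op d c L N)
    (FL_mono : forall phi psi, Cb phi -> Cb psi ->
       (forall t, mxle (phi t) (psi t)) ->
       forall t, mxle 0 (F psi t - F phi t + L (fun s => psi s - phi s) t))
    (phim_sub : sub_solution d c F phim)
    (phip_super : super_solution d c u2 F phip)
    (phim_le_phip : forall t, mxle (phim t) (phip t))
    (L_trans : commutes_with_translations L)
    (F_trans : commutes_with_translations F) :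
  (forall n, Cb (iterates N F L phip n) /\
             nondecreasing_vec (iterates N F L phip n)) /\
  (forall n t, mxle (iterates N F L phip n.+1 t) (iterates N F L phip n t)) /\
  exists phis : R -> 'cV[R]_m,
    [/\ bvp_solution d c u2 F phis,
        nondecreasing_vec phis &
        forall t, iterates N F L phip n t @[n --> \oo] --> phis t].
Proof.
have [phipc phip_gt0 phipnd [phipy phipNy]
  [t1 [phip2 phipF [lp [rp [phipl phipr rlp]]]]]] := phip_super.
have [phimc phim_ge0 phim_ncst _
  [t2 [phim2 phimF [lm [rm [phiml phimr lrm]]]]]] := phim_sub.
have phip_u2 := nondecreasing_vec_le_limit phipnd phipy.
have phipC : Cb phip.
  apply/CbP; split=> [i t|]; first exact: (cvg_colP phip _).1 (phipc t) i.
  exists `|u2| => t i; rewrite gtr0_norm//.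
  by apply: le_trans (phip_u2 t i 0) (le_trans (ler_norm _) (norm_entry_le _ _)).
have phimC : Cb phim.
  apply/CbP; split=> [i t|]; first exact: (cvg_colP phim _).1 (phimc t) i.
  exists `|u2| => t i; have := phim_ge0 t i 0; rewrite mxE => ge0.
  rewrite ger0_norm//; apply: le_trans (phim_le_phip t i 0) _.
  by apply: le_trans (phip_u2 t i 0) (le_trans (ler_norm _) (norm_entry_le _ _)).
have Tphip t : mxle (picard F L N phip t) (phip t).
  have [M phipM] := Cb2_onP phip2.
  apply: (super_solution_picard_le d_gt0 F_Cb L_Cb L_lin L_pcont N_le0 N_inv
    L_trans phipC phipM _ phipl phipr rlp) => s i st1.
  by have := phipF s st1 i 0; rewrite wave_opE mxE.
have Tphim t : mxle (phim t) (picard F L N phim t).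
  have [M phimM] := Cb2_onP phim2.
  apply: (sub_solution_le_picard d_gt0 F_Cb L_Cb L_lin L_pcont N_le0 N_inv
    L_trans phimC phimM _ phiml phimr lrm) => s i st2.
  by have := phimF s st2 i 0; rewrite wave_opE mxE.
have bt := iterates_between F_Cb L_Cb L_lin N_le0 N_inv FL_mono
  phimC phipC phim_le_phip Tphim Tphip.
have nd n : nondecreasing_vec (iterates N F L phip n).
  elim: n => [//|n IHn]; rewrite iteratesS.
  apply: (picard_nondecreasing F_Cb L_Cb L_lin N_le0 N_inv FL_mono) => //.
  by have [] := bt n.
split; first by move=> n; split=> //; have [] := bt n.
split; first by move=> n; have [] := bt n.
have [phis [phisC fix_phis phim_phis phis_phip phis_cvg]] := iterates_cvg_fixpoint
  d_gt0 F_Cb F_pcont L_Cb L_lin L_pcont N_le0 N_inv FL_mono L_trans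
  phimC phipC phim_le_phip Tphim Tphip.
have phisnd : nondecreasing_vec phis.
  move=> s t st i j; rewrite ord1.
  apply: ler_cvg_to ((cvg_colP (fun n => iterates N F L phip n s) _).1 (phis_cvg s) i)
    ((cvg_colP (fun n => iterates N F L phip n t) _).1 (phis_cvg t) i) _.
  by apply: nearW => n; exact: nd.
have phis_ge0 t : mxle 0 (phis t).
  by move=> i j; exact: le_trans (phim_ge0 t i j) (phim_phis t i j).
have phis_u2 t : mxle (phis t) u2.
  by move=> i j; exact: le_trans (phis_phip t i j) (phip_u2 t i j).
have [phis2 phisF] := picard_fixpoint_wave F_Cb L_Cb N_inv phisC fix_phis.
have [x phisx] := nondecreasing_vec_cvg phisnd phis_u2.
have phis_x := nondecreasing_vec_le_limit phisnd phisx.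
have x_zero : [set 0; u2] x.
  rewrite -F_zeros; split.
  - by move=> i j; exact: le_trans (phis_ge0 0 i j) (phis_x 0 i j).
  - move=> i j; rewrite ord1.
    apply: ler_cvg_to ((cvg_colP phis _).1 phisx i) (cvg_cst _) _.
    by apply: nearW => t; exact: phis_u2.
  - exact: (fixpoint_limit_is_zero F_Cb F_pcont L_Cb L_lin L_pcont N_le0 N_inv
      FL_mono L_trans F_trans phisC fix_phis phis_ge0 phis_u2 phisx).
have x_u2 : x = u2.
  case: x_zero => // x0; pose i := Ordinal m_gt0.
  exfalso; apply: (phim_ncst i); exists 0 => t; apply/eqP; rewrite eq_le.
  have := phim_ge0 t i 0; rewrite mxE => ->; rewrite andbT.
  have := le_trans (phim_phis t i 0) (phis_x t i 0).
  by rewrite x0 mxE.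
exists phis; split=> //; split=> //; last by rewrite -x_u2.
apply/cvg_colP => i; rewrite mxE.
apply: (@squeeze_cvgr _ _ _ _ (fun=> 0) (fun t => phip t i 0)).
- apply: nearW => t; rewrite phis_phip andbT.
  by have := phis_ge0 t i 0; rewrite mxE.
- exact: cvg_cst.
- by have := (cvg_colP phip _).1 phipNy i; rewrite mxE; exact.
Qed.
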